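(* Let $V$ be a real vector space and let $\beta\in GL(V)$ satisfy $\beta\circ\beta=\mathrm{id}$. Then for every $k$ the cohomology spaces $H^k(HL;\mathbb R)$ of the Hom-Lie algebra $(\mathfrak{gl}(V),[\cdot,\cdot]_\beta,\mathrm{Ad}_\beta)$ and $H^k(L;\mathbb R)$ of the Lie algebra $(\mathfrak{gl}(V),[\cdot,\cdot])$ are isomorphic: $$H^k(HL;\mathbb R)\cong H^k(L;\mathbb R).$$
   Context: Here $\wedge^k\mathfrak{gl}(V)^*$ denotes the space of skew-symmetric $k$-linear maps $\mathfrak{gl}(V)\times\cdots\times\mathfrak{gl}(V)\to\mathbb R$. For $A,B\in\mathfrak{gl}(V)$ put $[A,B]_\beta=\beta A\beta^{-1}B\beta^{-1}-\beta B\beta^{-1}A\beta^{-1}$, $\mathrm{Ad}_\beta(A)=\beta A\beta^{-1}$, and $[A,B]=AB-BA$. The operators $d,\hat d:\wedge^k\mathfrak{gl}(V)^*\to\wedge^{k+1}\mathfrak{gl}(V)^*$ are $$d\xi(x_1,\dots,x_{k+1})=\sum_{i<j}(-1)^{i+j}\xi([x_i,x_j]_\beta,\mathrm{Ad}_\beta(x_1),\dots,\widehat{\mathrm{Ad}_\beta(x_i)},\dots,\widehat{\mathrm{Ad}_\beta(x_j)},\dots,\mathrm{Ad}_\beta(x_{k+1})),$$ $$\hat d\xi(x_1,\dots,x_{k+1})=\sum_{i<j}(-1)^{i+j}\xi([x_i,x_j],x_1,\dots,\widehat{x_i},\dots,\widehat{x_j},\dots,x_{k+1}),$$ where a hat over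 an argument means that it is omitted. Both $(\oplus_k\wedge^k\mathfrak{gl}(V)^*,d)$ and $(\oplus_k\wedge^k\mathfrak{gl}(V)^*,\hat d)$ are cochain complexes. $Z^k(HL;\mathbb R)$ and $B^k(HL;\mathbb R)$ denote the closed and exact $k$-cochains of the complex with differential $d$, and $H^k(HL;\mathbb R)=Z^k(HL;\mathbb R)/B^k(HL;\mathbb R)$. $Z^k(L;\mathbb R)$ and $B^k(L;\mathbb R)$ denote the closed and exact $k$-cochains of the complex with differential $\hat d$, and $H^k(L;\mathbb R)=Z^k(L;\mathbb R)/B^k(L;\mathbb R)$. *)

(* Defs.v *)
From HB Require Import structures.
From mathcomp Require Import all_boot all_order all_fingroup all_algebra.
From mathcomp Require Import all_classical all_reals.

Set Implicit Arguments.
Unset Strict Implicit.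
Unset Printing Implicit Defensive.

Import Order.TTheory GRing.Theory Num.Theory.
Local Open Scope ring_scope.
Local Open Scope quotient_scope.

(* Library quotients are only Z-modules: add the scalar action on V / B. *)
Section LmodQuotient.
Variables (R : pzRingType) (V : lmodType R) (B : submodClosed V).

(* B seen as a subgroup; submodClosed does not inherit from zmodClosed. *)
Definition lmod_sub : V -> bool := fun v => v \in B.

Lemma lmod_sub_closed : zmod_closed lmod_sub.
Proof. exact: (GRing.submod_closedB (submodClosedP B)). Qed.

HB.instance Definition _ := GRing.isZmodClosed.Build V lmod_sub lmod_sub_closed.

Local Notation subgroup := (GRing.ZmodClosed.clone V lmod_sub _).

Definition lmod_quot : Type := Quotient.quot subgroup.
HB.instance Definition _ := GRing.Zmodule.on lmod_quot.

Definition lmod_proj (v : V) : lmod_quot :=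
  \pi_(Quotient.quot subgroup) v.

Lemma lmod_projP v w : lmod_proj v = lmod_proj w <-> v - w \in B.
Proof.
rewrite -[_ \in B]/(v - w \in subgroup) Quotient.idealrBE.
by split=> [vw|/eqP]; first exact/eqP.
Qed.

Lemma lmod_projK (q : lmod_quot) :
  lmod_proj (generic_quotient.repr (q : Quotient.quot subgroup)) = q.
Proof. exact: reprK. Qed.

Lemma lmod_projD : {morph lmod_proj : v w / v + w}.
Proof. by move=> v w; rewrite /lmod_proj !piE. Qed.

Definition lmod_quot_scale (a : R) (q : lmod_quot) : lmod_quot :=
  lmod_proj (a *: generic_quotient.repr (q : Quotient.quot subgroup)).

Lemma lmod_projZ a v : lmod_proj (a *: v) = lmod_quot_scale a (lmod_proj v).
Proof.
apply/lmod_projP; rewrite -scalerBr; apply: rpredZ.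
by apply/lmod_projP; rewrite lmod_projK.
Qed.

Lemma lmod_quot_scaleA a b q :
  lmod_quot_scale a (lmod_quot_scale b q) = lmod_quot_scale (a * b) q.
Proof. by rewrite -[q]lmod_projK -!lmod_projZ scalerA. Qed.

Lemma lmod_quot_scale1 : left_id 1 lmod_quot_scale.
Proof. by move=> q; rewrite -[q]lmod_projK -!lmod_projZ scale1r. Qed.

Lemma lmod_quot_scaleDr : right_distributive lmod_quot_scale +%R.
Proof.
move=> a p q; rewrite -[p]lmod_projK -[q]lmod_projK.
by rewrite -lmod_projD -!lmod_projZ scalerDr lmod_projD.
Qed.

Lemma lmod_quot_scaleDl q : {morph lmod_quot_scale^~ q : a b / a + b}.
Proof.
by move=> a b; rewrite -[q]lmod_projK -!lmod_projZ scalerDl lmod_projD.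
Qed.

HB.instance Definition _ := GRing.Zmodule_isLmodule.Build R lmod_quot
  lmod_quot_scaleA lmod_quot_scale1 lmod_quot_scaleDr lmod_quot_scaleDl.

Lemma lmod_proj_linear : linear lmod_proj.
Proof. by move=> a v w; rewrite lmod_projD lmod_projZ. Qed.

HB.instance Definition _ :=
  GRing.isLinear.Build R V lmod_quot *:%R lmod_proj lmod_proj_linear.

End LmodQuotient.

(* gl(V) for an arbitrary, possibly infinite-dimensional, V; the product is
   composition. It is only a pzRingType because V may be 0. *)
Section GeneralLinear.
Variables (R : comPzRingType) (V : lmodType R).

Definition gl : Type := {linear V -> V}.

HB.instance Definition _ := gen_eqMixin gl.
HB.instance Definition _ := gen_choiceMixin gl.

Implicit Types f g h : gl.

Lemma glP f g : (forall v, f v = g v) -> f = g.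
Proof.
case: f g => [f [[f0] [f1]]] [g [[g0] [g1]]] /= fg.
have {}fg : f = g by apply/funext.
rewrite {}fg in f0 f1 *.
by rewrite (Prop_irrelevance f0 g0) (Prop_irrelevance f1 g1).
Qed.

Definition gl_zero : gl := (\0 : {linear V -> V}).
Definition gl_opp f : gl := (\- f : {linear V -> V}).
Definition gl_add f g : gl := (f \+ g : {linear V -> V}).
Definition gl_scale (a : R) f : gl := (a \*: f : {linear V -> V}).
Definition gl_one : gl := (idfun : {linear V -> V}).
Definition gl_mul f g : gl := (f \o g : {linear V -> V}).

Lemma gl_addA : associative gl_add.
Proof. by move=> f g h; apply: glP => v /=; rewrite addrA. Qed.
Lemma gl_addC : commutative gl_add.
Proof. by move=> f g; apply: glP => v /=; rewrite addrC. Qed.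
Lemma gl_add0 : left_id gl_zero gl_add.
Proof. by move=> f; apply: glP => v /=; rewrite add0r. Qed.
Lemma gl_addN : left_inverse gl_zero gl_opp gl_add.
Proof. by move=> f; apply: glP => v /=; rewrite addNr. Qed.

HB.instance Definition _ :=
  GRing.isZmodule.Build gl gl_addA gl_addC gl_add0 gl_addN.

Lemma gl_mulA : associative gl_mul.
Proof. by move=> f g h; apply: glP. Qed.
Lemma gl_mul1l : left_id gl_one gl_mul.
Proof. by move=> f; apply: glP. Qed.
Lemma gl_mul1r : right_id gl_one gl_mul.
Proof. by move=> f; apply: glP. Qed.
Lemma gl_mulDl : left_distributive gl_mul +%R.
Proof. by move=> f g h; apply: glP. Qed.
Lemma gl_mulDr : right_distributive gl_mul +%R.
Proof. by move=> f g h; apply: glP => v /=; rewrite raddfD. Qed.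

HB.instance Definition _ := GRing.Zmodule_isPzRing.Build gl
  gl_mulA gl_mul1l gl_mul1r gl_mulDl gl_mulDr.

Lemma gl_scaleA a b f : gl_scale a (gl_scale b f) = gl_scale (a * b) f.
Proof. by apply: glP => v /=; rewrite scalerA. Qed.
Lemma gl_scale1 : left_id 1 gl_scale.
Proof. by move=> f; apply: glP => v /=; rewrite scale1r. Qed.
Lemma gl_scaleDr : right_distributive gl_scale +%R.
Proof. by move=> a f g; apply: glP => v /=; rewrite scalerDr. Qed.
Lemma gl_scaleDl f : {morph gl_scale^~ f : a b / a + b}.
Proof. by move=> a b; apply: glP => v /=; rewrite scalerDl. Qed.

HB.instance Definition _ := GRing.Zmodule_isLmodule.Build R gl
  gl_scaleA gl_scale1 gl_scaleDr gl_scaleDl.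

Lemma gl_scaleAl (a : R) f g : a *: (f * g) = (a *: f) * g.
Proof. exact: glP. Qed.
Lemma gl_scaleAr (a : R) f g : a *: (f * g) = f * (a *: g).
Proof. by apply: glP => v /=; rewrite linearZ. Qed.

Record GL := MkGL {
  GL_val :> gl;
  GL_inv : gl;
  GL_mulVr : GL_inv * GL_val = 1;
  GL_mulrV : GL_val * GL_inv = 1
}.

End GeneralLinear.

(* The twist is multiplicative; a Lie algebra is the case where it is id. *)
Record homLie (R : realType) := HomLie {
  hl_sort :> lmodType R;
  hl_bracket : hl_sort -> hl_sort -> hl_sort;
  hl_twist : {linear hl_sort -> hl_sort};
  hl_linear : forall y, linear (hl_bracket^~ y);
  hl_skew : forall x y, hl_bracket x y = - hl_bracket y x;
  hl_twistM : {morph hl_twist : x y / hl_bracket x y};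
  hl_jacobi : forall x y z,
    hl_bracket (hl_twist x) (hl_bracket y z)
    + hl_bracket (hl_twist y) (hl_bracket z x)
    + hl_bracket (hl_twist z) (hl_bracket x y) = 0
}.

Section GlHomLie.
Variables (R : realType) (V : lmodType R).

Definition gl_bracket (A B : gl V) : gl V := A * B - B * A.

Lemma gl_bracket_linear B : linear (gl_bracket^~ B).
Proof.
move=> a A A'; rewrite /gl_bracket mulrDl mulrDr -gl_scaleAl -gl_scaleAr.
by rewrite opprD addrACA scalerBr.
Qed.

Lemma gl_bracket_skew A B : gl_bracket A B = - gl_bracket B A.
Proof. by rewrite /gl_bracket opprB. Qed.

Lemma gl_bracket_jacobi A B C :
  gl_bracket A (gl_bracket B C) + gl_bracket B (gl_bracket C A)
  + gl_bracket C (gl_bracket A B) = 0.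
Proof.
rewrite /gl_bracket !mulrBl !mulrBr !mulrA !opprB !addrA.
rewrite !subrK [LHS](ACl ((1*8)*(2*5)*(3*6)*(4*7)))%AC /=.
by rewrite subrr !addNr subrr !addr0.
Qed.

Definition lie_gl : homLie R := @HomLie R (gl V) gl_bracket
  (idfun : {linear gl V -> gl V})
  gl_bracket_linear gl_bracket_skew (fun _ _ => erefl) gl_bracket_jacobi.

Variable beta : GL V.
Local Notation b := (GL_val beta).
Local Notation b' := (GL_inv beta).

Definition gl_bracket_beta (A B : gl V) : gl V :=
  b * A * b' * B * b' - b * B * b' * A * b'.

Definition gl_Ad (A : gl V) : gl V := b * A * b'.

Lemma gl_Ad_linear : linear gl_Ad.
Proof.
by move=> a A B; rewrite /gl_Ad mulrDr mulrDl -gl_scaleAr -gl_scaleAl.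
Qed.

HB.instance Definition _ :=
  GRing.isLinear.Build R (gl V) (gl V) *:%R gl_Ad gl_Ad_linear.

Lemma gl_bracket_beta_linear B : linear (gl_bracket_beta^~ B).
Proof.
move=> a A A'; rewrite /gl_bracket_beta !(mulrDr, mulrDl).
rewrite -!gl_scaleAr -!gl_scaleAl.
by rewrite opprD addrACA scalerBr.
Qed.

Lemma gl_bracket_beta_skew A B : gl_bracket_beta A B = - gl_bracket_beta B A.
Proof. by rewrite /gl_bracket_beta opprB. Qed.

Let betaVK (A : gl V) : A * b' * b = A.
Proof. by rewrite -mulrA GL_mulVr mulr1. Qed.

Lemma gl_AdM : {morph gl_Ad : A B / gl_bracket_beta A B}.
Proof.
by move=> A B; rewrite /gl_Ad /gl_bracket_beta mulrBr mulrBl !mulrA !betaVK.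
Qed.

Lemma gl_bracket_beta_jacobi A B C :
  gl_bracket_beta (gl_Ad A) (gl_bracket_beta B C)
  + gl_bracket_beta (gl_Ad B) (gl_bracket_beta C A)
  + gl_bracket_beta (gl_Ad C) (gl_bracket_beta A B) = 0.
Proof.
rewrite /gl_bracket_beta /gl_Ad !(mulrBl, mulrBr, mulrA) !betaVK !opprB !addrA.
rewrite !subrK [LHS](ACl ((1*8)*(2*5)*(3*6)*(4*7)))%AC /=.
by rewrite subrr !addNr subrr !addr0.
Qed.

Definition hom_lie_gl : homLie R := @HomLie R (gl V) gl_bracket_beta
  (gl_Ad : {linear gl V -> gl V})
  gl_bracket_beta_linear gl_bracket_beta_skew gl_AdM gl_bracket_beta_jacobi.

End GlHomLie.

Section Cochains.
Variables (R : realType) (g : homLie R).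
Local Notation br := (@hl_bracket R g).
Local Notation phi := (@hl_twist R g).

Definition upd k (x : 'I_k -> g) (i : 'I_k) (u : g) : 'I_k -> g :=
  fun j => if j == i then u else x j.

Definition multilinear k (f : ('I_k -> g) -> R^o) : Prop :=
  forall x i, linear (fun u => f (upd x i u)).

Definition skew_symmetric k (f : ('I_k -> g) -> R^o) : Prop :=
  forall x (s : 'S_k), f (fun a => x (s a)) = (-1) ^+ s * f x.

Definition cochain_pred k : pred (('I_k -> g) -> R^o) :=
  fun f => `[< multilinear f /\ skew_symmetric f >].

Lemma cochain_pred_closed k : submod_closed (@cochain_pred k).
Proof.
split=> [|a f h /asboolP[fl fs] /asboolP[hl hs]]; apply/asboolP; split.
- by move=> x i c u v; rewrite /= scaler0 addr0.
- by move=> x s; rewrite mulr0.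
- move=> x i c u v.
  rewrite -[LHS]/(a *: f (upd x i (c *: u + v)) + h (upd x i (c *: u + v))).
  rewrite fl hl -[RHS]/(c *: (a *: f (upd x i u) + h (upd x i u)) +
    (a *: f (upd x i v) + h (upd x i v))).
  by rewrite !scalerDr !scalerA [a * c]mulrC addrACA.
- move=> x s; rewrite -[LHS]/(a * f _ + h _) fs hs.
  by rewrite -[RHS]/((-1) ^+ s * (a * f x + h x)) mulrDr mulrCA.
Qed.

HB.instance Definition _ k := GRing.isSubmodClosed.Build R
  (('I_k -> g) -> R^o) (@cochain_pred k) (@cochain_pred_closed k).

Record cochain k := Cochain {
  cochain_val :> ('I_k -> g) -> R^o;
  _ : cochain_pred cochain_val
}.

HB.instance Definition _ k := [isSub for @cochain_val k].
HB.instance Definition _ k := [Choice of cochain k by <:].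
HB.instance Definition _ k := [SubChoice_isSubLmodule of cochain k by <:].


Lemma cochainP k (f h : cochain k) : (forall x, f x = h x) -> f = h.
Proof. by move=> fh; apply/val_inj/funext. Qed.

Lemma cochainE k a (f h : cochain k) x : (a *: f + h) x = a * f x + h x.
Proof. by rewrite -[cochain_val _]/(val (a *: f + h)) linearP. Qed.

Lemma cochainL k (f : cochain k) : multilinear f.
Proof. by have /asboolP[] := valP f. Qed.

Lemma cochainS k (f : cochain k) : skew_symmetric f.
Proof. by have /asboolP[] := valP f. Qed.

(* The argument list (br x_i x_j, phi x_0, .., phi x_k) without phi x_i and
   phi x_j, for i < j: the a-th remaining index is bump j (bump i a).
   Indices start at 0 instead of 1, which does not change (-1)^(i+j). *)
Definition d_arg k (x : 'I_k.+1 -> g) (i j : 'I_k.+1) : 'I_k -> g :=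
  fun a => if val a == 0%N then br (x i) (x j)
           else phi (x (inord (bump j (bump i (val a).-1)))).

Definition d_fun k (xi : ('I_k -> g) -> R^o) : ('I_k.+1 -> g) -> R^o :=
  fun x => \sum_(i < k.+1) \sum_(j < k.+1 | (i < j)%N)
             (-1) ^+ (i + j) * xi (d_arg x i j).

Lemma sum_pairs_perm n (G : 'I_n -> 'I_n -> R) (s : 'S_n) :
  (forall i j, i != j -> G i j = G j i) ->
  \sum_(i < n) \sum_(j < n | (i < j)%N) G (s i) (s j) =
  \sum_(i < n) \sum_(j < n | (i < j)%N) G i j.
Proof.
have dbl (H : 'I_n -> 'I_n -> R) : (forall i j, i != j -> H i j = H j i) ->
  (\sum_(i < n) \sum_(j < n | (i < j)%N) H i j) *+ 2 =
  \sum_(i < n) \sum_(j < n | i != j) H i j.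
  move=> Hs; rewrite mulr2n [X in _ + X](exchange_big_dep xpredT) //=.
  rewrite -big_split /=.
  apply: eq_bigr => i _; rewrite [RHS](bigID (fun j : 'I_n => i < j)%N) /=.
  congr (_ + _).
    by apply: eq_bigl => j; rewrite -val_eqE /=; case: ltngtP.
  rewrite (eq_bigl (fun j : 'I_n => (i != j) && ~~ (i < j)%N)); last first.
    by move=> j; rewrite -val_eqE /=; case: ltngtP.
  by apply: eq_bigr => j /andP[ij _]; rewrite Hs // eq_sym.
move=> Gs; apply: (@mulIf R 2%:R); first by rewrite pnatr_eq0.
rewrite !mulr_natr !dbl //; last first.
  by move=> i j ij; apply: Gs; rewrite (inj_eq perm_inj).
rewrite [RHS](reindex_inj (@perm_inj _ s)) /=; apply: eq_bigr => i _.
rewrite [RHS](reindex_inj (@perm_inj _ s)) /=; apply: eq_bigl => j.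
by rewrite (inj_eq perm_inj).
Qed.

Lemma lift_perm_ex n (p : 'S_n.+1) :
  p ord0 = ord0 -> exists t : 'S_n, p = lift_perm ord0 ord0 t.
Proof.
move=> p0.
have pl a : {b | p (lift ord0 a) = lift ord0 b}.
  case: (unliftP ord0 (p (lift ord0 a))) => [b|] E; first by exists b.
  by move: E; rewrite -[in RHS]p0 => /perm_inj.
pose f a := sval (pl a).
have fE a : p (lift ord0 a) = lift ord0 (f a) := svalP (pl a).
have inj : injective f.
  by move=> a b /(congr1 (lift ord0)); rewrite -!fE => /perm_inj/lift_inj.
exists (perm inj); apply/permP => a; case: (unliftP ord0 a) => [b|] ->.
  by rewrite lift_perm_lift permE fE.
by rewrite lift_perm_id.
Qed.

Section Differential.
Variables (m : nat) (xi : cochain m.+1).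
Implicit Types (x y : 'I_m.+2 -> g) (p q : 'S_m.+2).

Let o1 : 'I_m.+2 := lift ord0 ord0.

Let args y : 'I_m.+1 -> g :=
  fun a => if unlift ord0 a is Some b then phi (y (lift ord0 (lift ord0 b)))
           else br (y ord0) (y o1).

Let F y := xi (args y).

Let H p x : R := (-1) ^+ p * F (fun a => x (p a)).

Let args0 y : args y ord0 = br (y ord0) (y o1).
Proof. by rewrite /args unlift_none. Qed.

Let argsS y b : args y (lift ord0 b) = phi (y (lift ord0 (lift ord0 b))).
Proof. by rewrite /args liftK. Qed.

Let funE (A : Type) n (f h : 'I_n.+1 -> A) :
  f ord0 = h ord0 -> (forall b, f (lift ord0 b) = h (lift ord0 b)) -> f = h.
Proof.
by move=> f0 fS; apply/funext => a; case: (unliftP ord0 a) => [b|] ->.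
Qed.

Let br_linearr z : linear (br z).
Proof.
move=> a u v; rewrite hl_skew hl_linear opprD -scalerN.
by rewrite -!(hl_skew z).
Qed.

Let F_linear : multilinear F.
Proof.
move=> y l a u v; rewrite /F.
have up0 w t : args (upd y ord0 w) = upd (args (upd y ord0 t)) ord0 (br w (y o1)).
  by apply: funE => [|b]; rewrite /upd ?args0 ?argsS.
have up1 w t : args (upd y o1 w) = upd (args (upd y o1 t)) ord0 (br (y ord0) w).
  by apply: funE => [|b]; rewrite /upd ?args0 ?argsS.
have upS b w t : args (upd y (lift ord0 (lift ord0 b)) w) =
  upd (args (upd y (lift ord0 (lift ord0 b)) t)) (lift ord0 b) (phi w).
  apply: funE => [|c]; rewrite /upd ?args0 ?argsS //.
  by rewrite !(inj_eq lift_inj); case: ifP.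
case: (unliftP ord0 l) => [l'|] ->; last first.
  rewrite (up0 _ 0) hl_linear cochainL -!up0.
  by [].
case: (unliftP ord0 l') => [b|] ->; last first.
  by rewrite (up1 _ 0) br_linearr cochainL -!up1.
by rewrite (upS _ _ 0) linearP cochainL -!upS.
Qed.

Let F_tperm y : F (fun a => y (tperm ord0 o1 a)) = - F y.
Proof.
rewrite /F.
have -> : args (fun a => y (tperm ord0 o1 a)) =
          upd (args y) ord0 ((-1) *: br (y ord0) (y o1) + 0).
  apply: funE => [|b]; rewrite /upd ?args0 ?argsS.
    by rewrite tpermL tpermR eqxx addr0 scaleN1r -hl_skew.
  by rewrite tpermD.
have upd0 : xi (upd (args y) ord0 0) = 0.
  have := cochainL xi (args y) ord0 (-1) 0 0.
  by rewrite scaler0 addr0 scaleN1r addNr.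
rewrite cochainL upd0 addr0 scaleN1r; congr (- xi _).
by apply: funE => [|b]; rewrite /upd ?args0 ?argsS.
Qed.

Let F_fix y p : p ord0 = ord0 -> p o1 = o1 ->
  F (fun a => y (p a)) = (-1) ^+ p * F y.
Proof.
move=> /lift_perm_ex[q ->]; rewrite lift_perm_lift => /lift_inj.
move=> /lift_perm_ex[t ->]; set s := lift_perm ord0 ord0 t.
rewrite odd_lift_perm /= /F -cochainS.
congr (xi _).
apply: funE => [|b].
  by rewrite args0 /o1 lift_perm_lift /s !lift_perm_id args0.
by rewrite argsS /s !lift_perm_lift argsS.
Qed.

Let H_eq x p q : p ord0 = q ord0 -> p o1 = q o1 -> H p x = H q x.
Proof.
move=> pq0 pq1; pose r := (q * p^-1)%g.
have -> : q = (r * p)%g by rewrite mulgKV.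
rewrite /H (_ : (fun a => x ((r * p)%g a)) = (fun a => x (p (r a)))); last first.
  by apply/funext => a; rewrite permM.
rewrite (F_fix (fun a => x (p a))); first last.
- by rewrite permM -pq1 permK.
- by rewrite permM -pq0 permK.
by rewrite odd_permM signr_addb mulrACA mulrA -signr_addb addbb mul1r.
Qed.

Let H_tperm x p : H (tperm ord0 o1 * p)%g x = H p x.
Proof.
rewrite /H odd_permM odd_tperm /=.
rewrite (_ : (fun a => x ((tperm ord0 o1 * p)%g a)) =
             (fun a => x (p (tperm ord0 o1 a)))); last first.
  by apply/funext => a; rewrite permM.
by rewrite (F_tperm (fun a => x (p a))) mulrN signrN mulNr opprK.
Qed.

Let sigma (i j : 'I_m.+2) : 'S_m.+2 :=
  if unlift i j is Some j' then lift_perm ord0 i (lift_perm ord0 j' 1) else 1%g.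

Let sigma0 i j : i != j -> sigma i j ord0 = i.
Proof.
by rewrite /sigma; case: unliftP => [j'|->] //; rewrite ?lift_perm_id ?eqxx.
Qed.

Let sigma1 i j : i != j -> sigma i j o1 = j.
Proof.
rewrite /sigma; case: unliftP => [j' ->|->] //; rewrite ?eqxx // => _.
by rewrite lift_perm_lift lift_perm_id.
Qed.

Let d_term x (i j : 'I_m.+2) : (i < j)%N ->
  (-1) ^+ (i + j) * xi (d_arg x i j) = - H (sigma i j) x.
Proof.
move=> ij; rewrite /H /sigma.
case: unliftP => [j' jE|jE]; last by rewrite jE ltnn in ij.
have ij' : (i <= j')%N.
  move: ij; rewrite jE /= /bump; case: (leqP i j') => // h.
  by rewrite ltnNge /= add0n ltnW.
have jE' : j = j'.+1 :> nat by rewrite jE /= /bump ij'.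
rewrite !odd_lift_perm /= odd_perm1 addbF jE' addnS exprS mulN1r mulNr.
rewrite -signr_odd oddD; congr (- (_ * xi _)).
apply: funE => [|b]; first by rewrite args0 /o1 lift_perm_lift !lift_perm_id -jE.
rewrite argsS !lift_perm_lift perm1 /d_arg /=; congr (phi (x _)); apply: val_inj.
have bE : bump j (bump i b) = bump i (bump j' b).
  rewrite /bump jE'; case: (leqP j' b) => [j'b|bj'].
    by rewrite (leq_trans ij' j'b) !add1n ltnS j'b ltnW // ltnS (leq_trans ij').
  rewrite add0n; case: (leqP i b) => _; first by rewrite add1n ltnS leqNgt bj'.
  by rewrite ltnNge ltnW.
by rewrite /= inordK bE // (ltn_ord (lift i (lift j' b))).
Qed.

Lemma d_fun_linear : multilinear (d_fun xi).
Proof.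
move=> x l a u v; rewrite /d_fun /GRing.scale /= mulr_sumr -big_split /=.
apply: eq_bigr => i _; rewrite mulr_sumr -big_split /=.
apply: eq_bigr => j ij; rewrite !d_term // /H.
set p := sigma i j.
have E w : (fun b => upd x l w (p b)) = upd (fun b => x (p b)) (p^-1 l)%g w.
  by apply/funext => b; rewrite /upd (can2_eq (permK p) (permKV p)).
rewrite !E F_linear -[a *: F _]/(a * F _).
by rewrite mulrDr opprD mulrN mulrCA.
Qed.

Lemma d_fun_skew : skew_symmetric (d_fun xi).
Proof.
move=> x s; rewrite /d_fun.
transitivity (- \sum_(i < m.+2) \sum_(j < m.+2 | (i < j)%N)
  (-1) ^+ s * H (sigma (s i) (s j)) x).
  rewrite -sumrN; apply: eq_bigr => i _; rewrite -sumrN; apply: eq_bigr => j ij.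
  have ij' : i != j by rewrite -val_eqE /= ltn_eqF.
  rewrite d_term //; congr (- _).
  rewrite (@H_eq _ (sigma (s i) (s j)) (sigma i j * s)%g).
  - rewrite /H odd_permM signr_addb.
    rewrite (_ : (fun a => x ((sigma i j * s)%g a)) =
                 (fun a => x (s (sigma i j a)))); last first.
      by apply/funext => a; rewrite permM.
    by rewrite [_ ^+ _ * _ ^+ _]mulrC -mulrA signrMK.
  - by rewrite permM !sigma0 // (inj_eq perm_inj).
  - by rewrite permM !sigma1 // (inj_eq perm_inj).
rewrite (@sum_pairs_perm _ (fun i j => (-1) ^+ s * H (sigma i j) x)).
  rewrite mulr_sumr -sumrN; apply: eq_bigr => i _.
  rewrite mulr_sumr -sumrN; apply: eq_bigr => j ij.
  by rewrite d_term // mulrN.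
move=> i j ij; congr (_ * _).
have ji : j != i by rewrite eq_sym.
rewrite -[RHS]H_tperm; apply: H_eq; rewrite permM.
  by rewrite tpermL sigma0 // sigma1.
by rewrite tpermR sigma0 // sigma1.
Qed.

End Differential.

Lemma d_fun0 (xi : ('I_0 -> g) -> R^o) x : d_fun xi x = 0.
Proof. by rewrite /d_fun big1 // => i _; rewrite big1 // => j; rewrite !ord1. Qed.

Lemma d_fun_cochain k (xi : cochain k) : cochain_pred (d_fun xi).
Proof.
apply/asboolP; case: k xi => [|m] xi; last first.
  by split; [exact: d_fun_linear | exact: d_fun_skew].
split=> [x i a u v|x s]; rewrite !d_fun0 ?mulr0 //.
by rewrite scaler0 addr0.
Qed.

Definition d k (xi : cochain k) : cochain k.+1 := Cochain (d_fun_cochain xi).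

Lemma d_linear k : linear (@d k).
Proof.
move=> a xi eta; apply: cochainP => x.
rewrite cochainE /= /d_fun.
rewrite mulr_sumr -big_split; apply: eq_bigr => i _ /=.
rewrite mulr_sumr -big_split; apply: eq_bigr => j _ /=.
have := cochainE a xi eta (d_arg x i j) => /= ->.
by rewrite mulrDr mulrCA.
Qed.

HB.instance Definition _ k := GRing.isLinear.Build R
  (cochain k) (cochain k.+1) *:%R (@d k) (@d_linear k).

Definition closed_pred k : pred (cochain k) := fun xi => d xi == 0.

Lemma closed_pred_closed k : submod_closed (@closed_pred k).
Proof.
split=> [|a xi eta]; rewrite !unfold_in /closed_pred; first by rewrite linear0.
by move=> /eqP zxi /eqP zeta; rewrite linearP /= zxi zeta scaler0 addr0.
Qed.

HB.instance Definition _ k := GRing.isSubmodClosed.Build R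
  (cochain k) (@closed_pred k) (@closed_pred_closed k).

Record cocycle k := Cocycle {
  cocycle_val :> cochain k;
  _ : closed_pred cocycle_val
}.

HB.instance Definition _ k := [isSub for @cocycle_val k].
HB.instance Definition _ k := [Choice of cocycle k by <:].
HB.instance Definition _ k := [SubChoice_isSubLmodule of cocycle k by <:].

Definition is_exact k : cochain k -> Prop :=
  match k with
  | 0 => fun xi => xi = 0
  | l.+1 => fun xi => exists eta : cochain l, xi = d eta
  end.

(* B^k as a submodule of Z^k: the cocycles that are exact. *)
Definition coboundary_pred k : pred (cocycle k) := fun xi => `[< is_exact xi >].

Lemma coboundary_pred_closed k : submod_closed (@coboundary_pred k).
Proof.
rewrite /coboundary_pred.
split=> [|a xi eta /asboolP xiB /asboolP etaB]; apply/asboolP.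
  by case: k => [|l] //=; exists 0; rewrite linear0.
case: k xi eta xiB etaB => [|l] xi eta /= => [xi0 eta0|[al xE] [be eE]].
  by rewrite xi0 eta0 scaler0 addr0.
by exists (a *: al + be); rewrite linearP xE eE.
Qed.

HB.instance Definition _ k := GRing.isSubmodClosed.Build R
  (cocycle k) (@coboundary_pred k) (@coboundary_pred_closed k).

Definition cohomology k : lmodType R :=
  lmod_quot (GRing.SubmodClosed.clone R (cocycle k) (@coboundary_pred k) _).

End Cochains.

(* Main.v *)
Require Import Defs.
From HB Require Import structures.
From mathcomp Require Import all_boot all_order all_fingroup all_algebra.
From mathcomp Require Import all_classical all_reals.

(** Write [b] for [beta] and [A |-> A b], [A |-> b A] for the two translations
    of gl(V). Since [b b = 1], each of them carries the beta-bracket to the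
    commutator of the values of the other one:
      [[A,B]_b b = [b A, b B]]  and  [b [A,B]_b = [A b, B b]],
    and the twist [Ad_b] is the composite of the two. Hence pulling a cochain
    back along one translation and then applying the differential of the Hom-Lie
    algebra gives the pullback along the other translation of the Chevalley-
    Eilenberg differential ([d_pullback]). Pullback along the translations is
    therefore not quite a cochain map, but it still sends cocycles to cocycles
    and, because the relation holds with the translations exchanged,
    coboundaries to coboundaries. So it acts on cohomology. The
    translations are involutions and satisfy the same relations as maps from
    the Lie algebra to the Hom-Lie algebra, so the two actions are inverse
    to each other. *)

Set Implicit Arguments.
Unset Strict Implicit.
Unset Printing Implicit Defensive.

Import GRing.Theory.
Local Open Scope ring_scope.

Section QuotientMap.
Variables (R : pzRingType) (V W : lmodType R).
Variables (B : submodClosed V) (C : submodClosed W) (F : {linear V -> W}).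

Definition lmod_quot_map (q : lmod_quot B) : lmod_quot C :=
  lmod_proj C (F (generic_quotient.repr
    (q : Quotient.quot (GRing.ZmodClosed.clone V (lmod_sub B) _)))).

Hypothesis FB : forall v, v \in B -> F v \in C.

Lemma lmod_quot_mapE v :
  lmod_quot_map (lmod_proj B v) = lmod_proj C (F v).
Proof.
apply/lmod_projP; rewrite -linearB; apply: FB.
by apply/lmod_projP; rewrite lmod_projK.
Qed.

Lemma lmod_quot_map_linear : linear lmod_quot_map.
Proof.
move=> a p q; rewrite -[p]lmod_projK -[q]lmod_projK.
by rewrite -linearP !lmod_quot_mapE !linearP.
Qed.

End QuotientMap.

Section Pullback.
Variables (R : realType) (g h : homLie R).

Lemma pullback_cochain (T : {linear g -> h}) k (xi : cochain h k) :
  cochain_pred (fun x : 'I_k -> g => xi (T \o x)).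
Proof.
apply/asboolP; split=> [x i a u v|x s]; last exact: (cochainS xi (T \o x) s).
have E w : T \o upd x i w = upd (T \o x) i (T w).
  by apply/funext => j; rewrite /upd /=; case: ifP.
by rewrite !E linearP (cochainL xi (T \o x) i).
Qed.

Definition pullback (T : {linear g -> h}) k (xi : cochain h k) : cochain g k :=
  Cochain (pullback_cochain T xi).

Lemma pullback_linear T k : linear (@pullback T k).
Proof.
move=> a xi eta; apply: cochainP => x; rewrite [RHS]cochainE.
exact: cochainE.
Qed.

HB.instance Definition _ T k := GRing.isLinear.Build R
  (cochain h k) (cochain g k) *:%R (@pullback T k) (@pullback_linear T k).

(** The case [T = S] is that of a morphism of Hom-Lie algebras. Allowing
    [T <> S] is what lets one compare differentials with different twists:
    every argument of a term of the differential is either a bracket or a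
    twisted vector, and [T] sends both to expressions in values of [S]. *)
Definition intertwines (T S : {linear g -> h}) : Prop :=
  (forall x y, T (hl_bracket x y) = hl_bracket (S x) (S y)) /\
  (forall x, T (hl_twist g x) = hl_twist h (S x)).

Lemma d_pullback T S k (xi : cochain h k) : intertwines T S ->
  d (pullback T xi) = pullback S (d xi).
Proof.
move=> [Tbr Ttw]; apply: cochainP => x /=; rewrite /d_fun.
apply: eq_bigr => i _; apply: eq_bigr => j _; congr (_ * xi _).
by apply/funext => a; rewrite /d_arg /=; case: ifP.
Qed.

Section OnCohomology.
Variables (T S : {linear g -> h}).
Hypotheses (TS : intertwines T S) (ST : intertwines S T).

Lemma pullback_closed k (xi : cocycle h k) : closed_pred (pullback T xi).
Proof.
rewrite /closed_pred (d_pullback _ TS).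
by have /eqP -> := valP xi; rewrite linear0.
Qed.

Definition pullback_cocycle k (xi : cocycle h k) : cocycle g k :=
  Cocycle (pullback_closed xi).

Lemma pullback_cocycle_linear k : linear (@pullback_cocycle k).
Proof. by move=> a xi eta; apply: val_inj; rewrite /= !linearP. Qed.

HB.instance Definition _ k := GRing.isLinear.Build R
  (cocycle h k) (cocycle g k) *:%R (@pullback_cocycle k)
  (@pullback_cocycle_linear k).

(** A primitive of the pullback along [T] is the pullback along [S] of a
    primitive: this is why both orders of the pair are assumed. *)
Lemma pullback_coboundary k (xi : cocycle h k) :
  coboundary_pred xi -> coboundary_pred (pullback_cocycle xi).
Proof.
move=> /asboolP xiB; apply/asboolP; case: k xi xiB => [|k] xi /=.
  by move=> ->; rewrite linear0.
by move=> [eta ->]; exists (pullback S eta); rewrite (d_pullback _ ST).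
Qed.

Definition cohomology_pullback k : cohomology h k -> cohomology g k :=
  lmod_quot_map _ (@pullback_cocycle k).

Lemma cohomology_pullbackE k (xi : cocycle h k) :
  cohomology_pullback (lmod_proj _ xi) = lmod_proj _ (pullback_cocycle xi).
Proof. exact: (lmod_quot_mapE (@pullback_coboundary k)). Qed.

Lemma cohomology_pullback_linear k : linear (@cohomology_pullback k).
Proof. exact: (lmod_quot_map_linear (@pullback_coboundary k)). Qed.

End OnCohomology.
End Pullback.

Lemma cohomology_pullbackK (R : realType) (g h : homLie R)
    (T S : {linear g -> h}) (T' S' : {linear h -> g})
    (TS : intertwines T S) (ST : intertwines S T)
    (TS' : intertwines T' S') (ST' : intertwines S' T') k :
  cancel T' T ->
  cancel (@cohomology_pullback _ _ _ T S TS k)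
         (@cohomology_pullback _ _ _ T' S' TS' k).
Proof.
move=> TK q; rewrite -[q]lmod_projK !cohomology_pullbackE //.
congr (lmod_proj _ _); apply: val_inj; apply: cochainP => x /=.
by congr (cochain_val _ _); apply/funext => i /=; rewrite TK.
Qed.

Section Translations.
Variables (R : realType) (V : lmodType R) (b : gl V).

Definition gl_mull (A : gl V) : gl V := b * A.
Definition gl_mulr (A : gl V) : gl V := A * b.

Lemma gl_mull_linear : linear gl_mull.
Proof. by move=> a A B; rewrite /gl_mull mulrDr -gl_scaleAr. Qed.

Lemma gl_mulr_linear : linear gl_mulr.
Proof. by move=> a A B; rewrite /gl_mulr mulrDl -gl_scaleAl. Qed.

HB.instance Definition _ :=
  GRing.isLinear.Build R (gl V) (gl V) *:%R gl_mull gl_mull_linear.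
HB.instance Definition _ :=
  GRing.isLinear.Build R (gl V) (gl V) *:%R gl_mulr gl_mulr_linear.

End Translations.

Section Involution.
Variables (R : realType) (V : lmodType R) (beta : GL V).
Hypothesis beta_invol : GL_val beta * GL_val beta = 1.
Local Notation b := (GL_val beta).
Local Notation HL := (hom_lie_gl beta).
Local Notation L := (lie_gl V).

Lemma GL_inv_invol : GL_inv beta = b.
Proof. by rewrite -[LHS]mulr1 -beta_invol mulrA GL_mulVr mul1r. Qed.

Lemma mulr_involK (A : gl V) : A * b * b = A.
Proof. by rewrite -mulrA beta_invol mulr1. Qed.

Lemma mull_invol_intertwines :
  intertwines (gl_mull b : {linear HL -> L}) (gl_mulr b : {linear HL -> L}).
Proof.
split=> [A B|A] /=; rewrite /gl_mull /gl_mulr.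
  rewrite /gl_bracket_beta /gl_bracket GL_inv_invol.
  by rewrite mulrBr !mulrA beta_invol !mul1r.
by rewrite /gl_Ad GL_inv_invol !mulrA beta_invol mul1r.
Qed.

Lemma mulr_invol_intertwines :
  intertwines (gl_mulr b : {linear HL -> L}) (gl_mull b : {linear HL -> L}).
Proof.
split=> [A B|A] /=; rewrite /gl_mull /gl_mulr.
  by rewrite /gl_bracket_beta /gl_bracket GL_inv_invol mulrBl !mulrA !mulr_involK.
by rewrite /gl_Ad GL_inv_invol mulr_involK.
Qed.

Lemma mull_invol_intertwines_sym :
  intertwines (gl_mull b : {linear L -> HL}) (gl_mulr b : {linear L -> HL}).
Proof.
split=> [A B|A] /=; rewrite /gl_mull /gl_mulr.
  rewrite /gl_bracket_beta /gl_bracket GL_inv_invol.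
  by rewrite mulrBr !mulrA !mulr_involK.
by rewrite /gl_Ad GL_inv_invol !mulrA mulr_involK.
Qed.

Lemma mulr_invol_intertwines_sym :
  intertwines (gl_mulr b : {linear L -> HL}) (gl_mull b : {linear L -> HL}).
Proof.
split=> [A B|A] /=; rewrite /gl_mull /gl_mulr.
  rewrite /gl_bracket_beta /gl_bracket GL_inv_invol.
  by rewrite mulrBl !mulrA !beta_invol !mul1r !mulr_involK.
by rewrite /gl_Ad GL_inv_invol !mulrA beta_invol mul1r.
Qed.

End Involution.

Theorem theorem3p5 (R : realType) (V : lmodType R) (beta : GL V)
    (beta_invol : GL_val beta * GL_val beta = 1) (k : nat) :
  exists f : {linear cohomology (hom_lie_gl beta) k -> cohomology (lie_gl V) k},
    bijective f.
Proof.
have rl := mulr_invol_intertwines beta_invol.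
have lr := mull_invol_intertwines beta_invol.
have rl' := mulr_invol_intertwines_sym beta_invol.
have lr' := mull_invol_intertwines_sym beta_invol.
have lin := cohomology_pullback_linear rl' lr' (k := k).
pose f : {linear cohomology (hom_lie_gl beta) k -> cohomology (lie_gl V) k} :=
  HB.pack (cohomology_pullback rl' (k := k))
    (GRing.isLinear.Build _ _ _ _ _ lin).
exists f; exists (cohomology_pullback rl (k := k)).
  by apply: cohomology_pullbackK => // A; apply: mulr_involK.
by apply: cohomology_pullbackK => // A; apply: mulr_involK.
Qed.
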